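(* Let $G_{r,s}$ be a connected split graph with vertex partition $V(G_{r,s})=Q\cup I$, where $Q$ induces a clique on $r$ vertices and $I$ is an independent set on $s$ vertices, and let $k\in\{2,\ldots,r+s-1\}$. Then $${\rm sgp}_k(G_{r,s})\ge \max\{r+i(G_{r,s}),\ s+u_k(G_{r,s}),\ k\}.$$
   Context: Write $I=\{v_1,\ldots,v_s\}$ ordered so that $\delta(v_1)\ge\cdots\ge\delta(v_s)$, where $\delta$ denotes degree. Define $i(G_{r,s})=0$ if $\delta(v_1)\le r-k+1$; otherwise $i(G_{r,s})$ is the largest $i\in\{1,\ldots,s\}$ with $\delta(v_i)>r-k+i$. Let $U$ be the set of universal vertices (vertices adjacent to all other vertices) of $G_{r,s}$, and set $u_k(G_{r,s})=|U|$ if $k>s$ and $u_k(G_{r,s})=0$ if $k\le s$. For nonempty $W\subseteq V(G)$, the Steiner distance is the minimum number of edges of a connected subgraph containing $W$; such a minimum subgraph is a tree, a Steiner $W$-tree. A set $A\subseteq V(G)$ is a $k$-Steiner general position set if for every $k$-subset $B\subseteq A$ and every Steiner $B$-tree $T_B$, $V(T_B)\cap A=B$; ${\rm sgp}_k(G)$ is the largest size of such a set.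
   Formalization: It is additionally assumed that no vertex of I is universal; this excludes only s = 1 with the vertex of I adjacent to all of Q (a complete graph), where s + u_k = r + 2 exceeds the number of vertices and the inequality fails. *)

(* Defs.v *)
(* MathComp. A simple graph is a symmetric irreflexive relation e on a finType. *)
From mathcomp Require Import all_boot.

Set Implicit Arguments.
Unset Strict Implicit.
Unset Printing Implicit Defensive.

Section SteinerGeneralPosition.
Variables (T : finType) (e : rel T).

Definition connected_graph : bool := [forall x, forall y, connect e x y].

Definition clique (Q : {set T}) : bool :=
  [forall x in Q, forall y in Q, (x != y) ==> e x y].

Definition independent (I : {set T}) : bool :=
  [forall x in I, forall y in I, ~~ e x y].

Definition degree (x : T) : nat := #|[set y | e x y]|.

Definition universal_vertices : {set T} :=
  [set x | [forall y, (y != x) ==> e x y]].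

(* A pair H of a vertex set H.1 and a set H.2 of edges, an edge being the    *)
(* two-element set of its ends.                                               *)
Definition subgraph (H : {set T} * {set {set T}}) : bool :=
  [forall f in H.2, (f \subset H.1) &&
     [exists x, exists y, e x y && (f == [set x; y])]].

Definition connected_subgraph (H : {set T} * {set {set T}}) : bool :=
  subgraph H &&
  [forall x in H.1, forall y in H.1,
     connect [rel u v | [set u; v] \in H.2] x y].

Definition connects (W : {set T}) (H : {set T} * {set {set T}}) : bool :=
  connected_subgraph H && (W \subset H.1).

(* #|H.2| is then the Steiner distance of W. *)
Definition steiner_tree (W : {set T}) (H : {set T} * {set {set T}}) : bool :=
  connects W H && [forall H', connects W H' ==> (#|H.2| <= #|H'.2|)].

Definition sgp_set (k : nat) (A : {set T}) : bool :=
  [forall B : {set T}, (B \subset A) && (#|B| == k) ==>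
     [forall H, steiner_tree B H ==> (H.1 :&: A == B)]].

Definition sgp (k : nat) : nat := \max_(A : {set T} | sgp_set k A) #|A|.

Definition degree_ordering (I : {set T}) (vs : seq T) : bool :=
  perm_eq vs (enum I) && sorted (fun x y => degree y <= degree x) vs.

(* Here v_i is the entry of vs of index i.-1, and the comparisons of          *)
(* delta(v_i) with the integer r - k + i are written without subtraction.     *)
(* The value is 0 when vs is empty.                                           *)
Definition i_split (r k : nat) (vs : seq T) : nat :=
  let delta i := nth 0 [seq degree v | v <- vs] i.-1 in
  if delta 1 + k <= r + 1 then 0
  else \max_(1 <= i < (size vs).+1 | delta i + k > r + i) i.

(* All universal vertices are counted. One of them lies in the independent    *)
(* part I only if I is a singleton and the graph is complete; then, for       *)
(* k > 1 = s, s + u_split s k exceeds the number of vertices.                 *)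
Definition u_split (s k : nat) : nat :=
  if s < k then #|universal_vertices| else 0.

End SteinerGeneralPosition.

(* Main.v *)
(* A connected subgraph on a vertex set W has at least |W| - 1 edges, and a
   connected W has a spanning tree, so the vertex set of a Steiner B-tree has
   least cardinality among the connected vertex sets containing B.  Hence if B
   itself is connected, every Steiner B-tree has vertex set exactly B.  In a
   split graph a vertex set is connected as soon as each of its vertices in I
   has a neighbour in its clique part.

   For A = Q :|: {v_1, ..., v_i}, a k-subset B of A misses fewer vertices of Q
   than any v_j with j <= i has neighbours, so B is connected.  For
   A = I :|: U and k > s, B contains a universal vertex, so B is connected.
   For A = I and k <= s, a vertex of I outside B is never in a Steiner B-tree:
   removing it keeps the vertex set connected. *)
Require Import Defs.
From mathcomp Require Import all_boot.
From mathcomp Require Import zify.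

Set Implicit Arguments.
Unset Strict Implicit.
Unset Printing Implicit Defensive.

(** * Spanning trees of connected vertex sets *)

Section SpanningTrees.
Variables (T : finType) (g : rel T).

Definition edge_rel (F : {set {set T}}) : rel T := [rel u v | [set u; v] \in F].

Lemma edge_rel_sym (F : {set {set T}}) : symmetric (edge_rel F).
Proof. by move=> x y; rewrite /edge_rel /= setUC. Qed.

Lemma connect_leaves (S : {set T}) (x y : T) :
  connect g x y -> x \in S -> y \notin S ->
  exists u v, [/\ u \in S, v \notin S & g u v].
Proof.
case/connectP=> p; elim: p x => [|z p IHp] x /=; first by move=> _ -> ->.
case/andP=> gxz gp yE xS yS; have [zS|zS] := boolP (z \in S).
  exact: IHp gp yE zS yS.
by exists x, z.
Qed.

(** A tree grows from [x0] by one vertex and one edge at a time: while it misses a vertex of [W],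
    some [g]-step leaves it. The relation [g] is kept general, to serve both for the edges of a
    given subgraph and for the graph restricted to a vertex set. *)
Lemma spanning_tree (W : {set T}) (x0 : T) :
  x0 \in W ->
  (forall x y, g x y -> x \in W -> y \in W) ->
  {in W &, forall x y, connect g x y} ->
  exists F : {set {set T}},
    [/\ forall f, f \in F -> exists x y, [/\ x \in W, y \in W, g x y & f = [set x; y]],
        {in W &, forall x y, connect (edge_rel F) x y} &
        #|F|.+1 = #|W|].
Proof.
move=> x0W Wcl Wconn.
suff /(_ #|W|) [] // : forall n, 0 < n <= #|W| ->
    exists (S : {set T}) (F : {set {set T}}),
    [/\ #|S| = n /\ x0 \in S, S \subset W,
        forall f, f \in F ->
          exists x y, [/\ x \in S, y \in S, g x y & f = [set x; y]],
        {in S, forall x, connect (edge_rel F) x0 x} &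
        #|F|.+1 = n].
- by rewrite leqnn andbT card_gt0; apply/set0Pn; exists x0.
- move=> S [F [[cS _] SW FS Sc cF]].
  have SE : S = W by apply/eqP; rewrite eqEcard SW cS leqnn.
  exists F; rewrite -SE cS; split=> // x y xS yS.
  apply: connect_trans (Sc y yS).
  by rewrite (sym_connect_sym (@edge_rel_sym F)) Sc.
case=> [//|]; elim=> [_|n IHn /andP[_ nW]].
  exists [set x0], set0; split=> //; first by rewrite cards1 set11.
  - by rewrite sub1set.
  - by move=> f; rewrite inE.
  - by move=> x /set1P->.
  - by rewrite cards0.
have [|S [F [[cS x0S] SW FS Sc cF]]] := IHn; first exact: ltnW nW.
have /subsetPn[y yW yS] : ~~ (W \subset S).
  by apply: contraL nW => /subset_leq_card; rewrite cS -leqNgt.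
have [u [v [uS vS guv]]] := connect_leaves (Wconn _ _ x0W yW) x0S yS.
have uW := subsetP SW u uS; have vW := Wcl u v guv uW.
exists (v |: S), ([set u; v] |: F); split.
- by rewrite cardsU1 vS cS inE x0S orbT.
- by rewrite subUset sub1set vW.
- move=> f /setU1P[->|/FS[a [b [aS bS gab ->]]]].
    by exists u, v; rewrite !inE uS eqxx orbT.
  by exists a, b; rewrite !inE aS bS !orbT.
- have mono : subrel (connect (edge_rel F)) (connect (edge_rel ([set u; v] |: F))).
    by apply: connect_sub => a b ab; apply: connect1; apply: setU1r.
  move=> z /setU1P[->|/Sc/mono//].
  apply: connect_trans (mono _ _ (Sc u uS)) _.
  by apply: connect1; apply: setU11.
(* The added edge is new: the edges of [F] have both ends in [S], which misses [v]. *)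
- rewrite cardsU1; suff -> : [set u; v] \notin F by rewrite add1n cF.
  apply: contra vS => /FS[a [b [aS bS _ /setP/(_ v)]]].
  by rewrite !inE eqxx orbT => /esym/orP[]/eqP->.
Qed.

End SpanningTrees.

(** * Steiner trees in split graphs *)

Section SplitGraphs.
Variables (T : finType) (e : rel T) (Q I : {set T}).
Hypotheses (e_sym : symmetric e) (e_irr : irreflexive e).
Hypotheses (QI_cover : Q :|: I = [set: T]).
Hypotheses (Q_clique : clique e Q) (I_indep : independent e I).

Lemma notin_clique_part x : x \notin Q -> x \in I.
Proof. by move=> xQ; have := in_setT x; rewrite -QI_cover inE (negbTE xQ). Qed.

Lemma clique_edge x y : x \in Q -> y \in Q -> x != y -> e x y.
Proof.
move=> xQ yQ; apply/implyP; move: Q_clique; rewrite /clique.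
by move=> /forall_inP/(_ x xQ)/forall_inP/(_ y yQ).
Qed.

Lemma indep_edge x y : x \in I -> y \in I -> ~~ e x y.
Proof.
move=> xI yI; move: I_indep; rewrite /independent.
by move=> /forall_inP/(_ x xI)/forall_inP/(_ y yI).
Qed.

Lemma nbr_in_clique x y : x \in I -> e x y -> y \in Q.
Proof.
move=> xI; apply: contraTT => /notin_clique_part; exact: indep_edge.
Qed.

Lemma connected_subgraph_card (H : {set T} * {set {set T}}) :
  connected_subgraph e H -> #|H.1| <= #|H.2|.+1.
Proof.
case/andP=> /forall_inP sH /forall_inP cH.
have [->|/set0Pn[x0 x0H]] := eqVneq H.1 set0; first by rewrite cards0.
have [] := @spanning_tree T (edge_rel H.2) H.1 x0 x0H.
- move=> x y /sH /andP[/subsetP sxy _] _; apply: sxy.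
  by rewrite !inE eqxx orbT.
- by move=> x y xH yH; move/forall_inP: (cH x xH); apply.
move=> F [FH _ <-]; rewrite ltnS; apply/subset_leq_card/subsetP => f.
by case/FH=> x [y [_ _ ? ->]].
Qed.

Lemma connected_subgraph_nbr (H : {set T} * {set {set T}}) x :
  connected_subgraph e H -> 1 < #|H.1| -> x \in H.1 ->
  exists2 y, y \in H.1 & e x y.
Proof.
case/andP=> /forall_inP sH /forall_inP cH H1 xH.
have /subsetPn[y yH] : ~~ (H.1 \subset [set x]).
  by apply: contraL H1 => /subset_leq_card; rewrite cards1 -leqNgt.
rewrite inE => yx.
have /forall_inP/(_ y yH)/connectP[[|z p] /=] := cH x xH.
  by move=> _ yE; rewrite yE eqxx in yx.
case/andP=> /sH /andP[/subsetP sxz /existsP[a /existsP[b /andP[eab /eqP E]]]] _ _.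
exists z; first by apply: sxz; rewrite !inE eqxx orbT.
(* Both [a] and [b] lie in the pair of [x] and [z]; being distinct, they are [x] and [z] in one of
   the two orders. *)
have ab : a != b by apply: contraTneq eab => ->; rewrite e_irr.
move/setP: E => E; move: (E a) (E b) (E x) (E z); rewrite !inE !eqxx ?orbT /=.
case/orP=> /eqP aE; case/orP=> /eqP bE _ _; subst => //.
- by rewrite eqxx in ab.
- by rewrite e_sym.
- by rewrite eqxx in ab.
Qed.

(** Inside [W] each vertex reaches [Q] in at most one step, and two vertices of [Q] are equal or
    adjacent. *)
Lemma connected_clique_dominated (W : {set T}) :
  {in W :&: I, forall x, exists2 y, y \in W & e x y} ->
  {in W &, forall x y,
    connect [rel u v | [&& u \in W, v \in W & e u v]] x y}.
Proof.
move=> dom; set g : rel T := [rel u v | _].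
have g_sym : connect_sym g.
  by apply: sym_connect_sym => u v; rewrite /g /= e_sym andbCA.
have toQ x : x \in W -> exists2 q, q \in W :&: Q & connect g x q.
  move=> xW; have [xQ|/notin_clique_part xI] := boolP (x \in Q).
    by exists x; rewrite ?inE ?xW.
  have [|y yW exy] := dom x; first by rewrite inE xW.
  exists y; first by rewrite inE yW (nbr_in_clique xI).
  by apply: connect1; rewrite /g /= xW yW.
move=> x y /toQ[p /setIP[pW pQ] xp] /toQ[q /setIP[qW qQ] yq].
apply: (connect_trans xp); rewrite g_sym; apply: (connect_trans yq).
have [->//|qp] := eqVneq q p.
by apply: connect1; rewrite /g /= qW pW clique_edge.
Qed.

(** A spanning tree of [W] competes with [H], so minimality in edges passes to vertices: |H.1| <=
    |H.2| + 1 <= |F| + 1 = |W|. *)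
Lemma steiner_tree_card_le (B W : {set T}) (H : {set T} * {set {set T}}) :
  steiner_tree e B H -> B \subset W -> 0 < #|W| ->
  {in W :&: I, forall x, exists2 y, y \in W & e x y} -> #|H.1| <= #|W|.
Proof.
case/andP=> /andP[cH _] /forall_inP minH BW /card_gt0P[x0 x0W].
move/connected_clique_dominated => cW.
have [|F [FW Fc <-]] := spanning_tree x0W _ cW; first by move=> x y /and3P[].
apply: leq_trans (connected_subgraph_card cH) _; rewrite ltnS.
apply: (minH (W, F)); rewrite /connects BW andbT; apply/andP; split=> /=.
  apply/forall_inP=> f /FW[x [y [xW yW /and3P[_ _ exy] ->]]]; apply/andP; split.
    by apply/subsetP=> z /set2P[]->.
  by apply/existsP; exists x; apply/existsP; exists y; rewrite exy eqxx.
by apply/forall_inP=> x xW; apply/forall_inP=> y yW; apply: Fc.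
Qed.

Lemma steiner_tree_span (B : {set T}) (H : {set T} * {set {set T}}) :
  steiner_tree e B H -> 0 < #|B| ->
  {in B :&: I, forall x, exists2 y, y \in B & e x y} -> H.1 = B.
Proof.
move=> HB B0 dom; have /andP[/andP[_ BH] _] := HB.
apply/esym/eqP; rewrite eqEcard BH /=.
exact: steiner_tree_card_le HB (subxx B) B0 dom.
Qed.

Lemma steiner_tree_indep (B : {set T}) (H : {set T} * {set {set T}}) :
  steiner_tree e B H -> 1 < #|B| -> H.1 :&: I \subset B.
Proof.
move=> HB B1; have /andP[/andP[cH BH] _] := HB.
have H1 := leq_trans B1 (subset_leq_card BH).
apply/subsetP=> v /setIP[vH vI]; apply: contraT => vB.
have BHv : B \subset H.1 :\ v by rewrite subsetD1 BH.
have : #|H.1| <= #|H.1 :\ v|.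
  apply: (steiner_tree_card_le HB BHv).
    exact: leq_trans (ltnW B1) (subset_leq_card BHv).
  move=> x /setIP[/setD1P[_ xH] xI].
  have [y yH exy] := connected_subgraph_nbr cH H1 xH; exists y => //.
  (* Deleting [v] costs [x] no neighbour, since [x] and [v] both lie in [I]. *)
  by rewrite !inE yH andbT; apply: contraTneq exy => ->; exact: indep_edge.
by rewrite [X in X <= _](cardsD1 v) vH add1n ltnn.
Qed.

(** Pigeonhole in [Q]: the neighbourhood of [x] and [B] both lie there and are together too large to
    be disjoint. *)
Lemma degree_nbr_in (B : {set T}) x :
  x \in I -> B \subset Q -> #|Q| < degree e x + #|B| ->
  exists2 y, y \in B & e x y.
Proof.
move=> xI BQ hlt; set N := [set y | e x y].
have NQ : N \subset Q by apply/subsetP=> y; rewrite inE; apply: nbr_in_clique.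
suff /set0Pn[y /setIP[]] : N :&: B != set0 by rewrite inE => exy yB; exists y.
apply: contraTneq hlt => NB0; rewrite -leqNgt /degree -/N -cardsUI NB0 cards0 addn0.
by apply: subset_leq_card; rewrite subUset NQ.
Qed.

(** * The individual lower bounds *)

Lemma sgp_ge (k : nat) (A : {set T}) :
  (forall (B : {set T}) H, B \subset A -> #|B| = k -> steiner_tree e B H -> H.1 :&: A = B) ->
  #|A| <= sgp e k.
Proof.
move=> sgpA; apply: leq_bigmax_cond; apply/forallP=> B; apply/implyP=> /andP[BA /eqP cB].
by apply/forallP=> H; apply/implyP=> HB; apply/eqP/sgpA.
Qed.

(** The only [k]-subset of a set of size [k] is the set itself. *)
Lemma sgp_ge_k (k : nat) : k <= #|T| -> k <= sgp e k.
Proof.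
case/card_geqP=> s [us ss _].
have cA : #|[set x in s]| = k by rewrite cardsE; move/card_uniqP: us => ->.
rewrite -{1}cA; apply: sgp_ge => B H BA cB /andP[/andP[_ BH] _].
have <- : B = [set x in s] by apply/eqP; rewrite eqEcard BA cA cB leqnn.
exact/setIidPr.
Qed.

Lemma sgp_ge_indep (k : nat) : 1 < k -> #|I| <= sgp e k.
Proof.
move=> k1; apply: sgp_ge => B H BI cB HB.
have /andP[/andP[_ BH] _] := HB.
by apply/eqP; rewrite eqEsubset steiner_tree_indep ?cB //= subsetI BH.
Qed.

Lemma sgp_ge_universal (k : nat) :
  [disjoint universal_vertices e & I] -> #|I| < k ->
  #|I| + #|universal_vertices e| <= sgp e k.
Proof.
move=> UI Ik; have <- : #|I :|: universal_vertices e| = #|I| + #|universal_vertices e|.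
  by rewrite cardsU setIC (disjoint_setI0 UI) cards0 subn0.
apply: sgp_ge => B H BA cB HB.
have B0 : 0 < #|B| by rewrite cB (leq_ltn_trans _ Ik).
have /subsetPn[u uB uI] : ~~ (B \subset I).
  by apply: contraL Ik => /subset_leq_card; rewrite cB -leqNgt.
rewrite (steiner_tree_span HB B0); first exact/setIidPl.
move=> x /setIP[xB xI]; exists u => //.
have /setUP[uI'|] := subsetP BA u uB; first by rewrite uI' in uI.
rewrite inE e_sym => /forallP/(_ x)/implyP; apply.
by apply: contraNneq uI => <-.
Qed.

Lemma sgp_ge_high_degree (k : nat) (J : {set T}) :
  0 < k -> [disjoint Q & I] -> J \subset I ->
  {in J, forall x, #|Q| + #|J| < degree e x + k} ->
  #|Q| + #|J| <= sgp e k.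
Proof.
move=> k0 QI JI degJ; have QJ : Q :&: J = set0.
  by apply/disjoint_setI0/(disjointWr JI).
have <- : #|Q :|: J| = #|Q| + #|J| by rewrite cardsU QJ cards0 subn0.
apply: sgp_ge => B H BA cB HB.
rewrite (steiner_tree_span HB); first exact/setIidPl; first by rewrite cB.
move=> x /setIP[xB xI].
have xJ : x \in J.
  have /setUP[xQ|//] := subsetP BA x xB.
  by have /disjointFr := QI => /(_ x xQ); rewrite xI.
have [||y /setIP[yB _] exy] := @degree_nbr_in (B :&: Q) x xI; last by exists y.
  exact: subsetIr.
(* What [B] has outside [Q] lies in [J], so [B] keeps at least k - |J| vertices of [Q], enough for
   the pigeonhole. *)
have : #|B| <= #|B :&: Q| + #|J|.
  rewrite -(cardsID Q B) leq_add2l; apply/subset_leq_card/subsetP=> z /setDP[zB zQ].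
  by have := subsetP BA z zB; rewrite inE (negbTE zQ).
by have := degJ x xJ; rewrite cB; lia.
Qed.

End SplitGraphs.

Lemma i_splitP (T : finType) (e : rel T) (r k : nat) (vs : seq T) :
  i_split e r k vs = 0 \/
  0 < i_split e r k vs <= size vs /\
  r + i_split e r k vs <
    nth 0 [seq degree e v | v <- vs] (i_split e r k vs).-1 + k.
Proof.
rewrite /i_split; case: ifP => _; first by left.
(* A maximum is either the default 0 or attained by an admissible index, so the disjunction survives
   [maxn]. *)
rewrite big_nat_cond; elim/big_ind: _ => [|x y Px Py|i /andP[ib id]]; first by left.
  by case: (leqP x y) => xy; rewrite ?(maxn_idPr xy) ?(maxn_idPl (ltnW xy)).
by right.
Qed.

(** Degrees do not increase along [vs], so the last entry of a prefix has the least degree in it;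
    the bound on v_i then holds for all of v_1, ..., v_i. *)
Lemma take_degree_ordering (T : finType) (e : rel T) (I : {set T}) (vs : seq T) (i : nat) :
  degree_ordering e I vs -> i <= size vs ->
  [/\ [set x in take i vs] \subset I,
      #|[set x in take i vs]| = i &
      {in take i vs, forall x,
        nth 0 [seq degree e v | v <- vs] i.-1 <= degree e x}].
Proof.
case/andP=> vsI srt ib; have uvs : uniq vs by rewrite (perm_uniq vsI) enum_uniq.
split.
- by apply/subsetP=> x; rewrite inE => /mem_take; rewrite (perm_mem vsI) mem_enum.
- by rewrite cardsE (card_uniqP (take_uniq i uvs)) size_takel.
move=> x xi; set j := index x (take i vs).
have ji : j < i by rewrite -[X in _ < X](size_takel ib) index_mem.
(* The member [x] forces [i] to be positive, so [i.-1] is a true index and not a truncated one. *)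
have i1 : i.-1 < size vs by lia.
have xj : nth x vs j = x by rewrite -(nth_take x ji) nth_index.
rewrite (nth_map x) // -{2}xj.
have trans : transitive (fun u v => degree e v <= degree e u).
  by move=> a b c ab bc; apply: leq_trans bc ab.
apply: (sorted_leq_nth trans _ x srt); rewrite ?inE //; first exact: leq_trans ji ib.
by rewrite -ltnS prednK // (leq_ltn_trans _ ji).
Qed.

Theorem theorem6p1 (T : finType) (e : rel T) (Q I : {set T}) (r s k : nat)
    (vs : seq T)
    (e_sym : symmetric e) (e_irr : irreflexive e)
    (e_conn : connected_graph e)
    (QI_cover : Q :|: I = [set: T]) (QI_disj : [disjoint Q & I])
    (Q_clique : clique e Q) (I_indep : independent e I)
    (cardQ : #|Q| = r) (cardI : #|I| = s)
    (vs_ord : degree_ordering e I vs)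
    (UI_disj : [disjoint universal_vertices e & I])
    (k_bounds : 2 <= k <= r + s - 1) :
  maxn (r + i_split e r k vs) (maxn (s + u_split e s k) k) <= sgp e k.
Proof.
have [k1 kr] := andP k_bounds.
have cardT : #|T| = r + s.
  by rewrite -cardsT -QI_cover cardsU (disjoint_setI0 QI_disj) cards0 subn0 cardQ cardI.
rewrite !geq_max; apply/and3P; split.
- have [iE|[/andP[i0 ib] id]] := i_splitP e r k vs.
    (* With index 0 the set is [Q] alone, that is, [J] is empty. *)
    rewrite iE -cardQ -(@cards0 T).
    apply: (sgp_ge_high_degree e_sym QI_cover Q_clique I_indep (ltnW k1) QI_disj).
      exact: sub0set.
    by move=> x; rewrite inE.
  have [JI cJ degJ] := take_degree_ordering vs_ord ib.
  rewrite -[X in _ + X]cJ -{1}cardQ.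
  apply: (sgp_ge_high_degree e_sym QI_cover Q_clique I_indep (ltnW k1) QI_disj JI).
  by move=> x; rewrite inE cJ cardQ => /degJ; lia.
- rewrite /u_split; case: ifP => sk; rewrite -cardI.
    by apply: (sgp_ge_universal e_sym QI_cover Q_clique I_indep UI_disj); rewrite cardI.
  by rewrite addn0; apply: (sgp_ge_indep e_sym e_irr QI_cover Q_clique I_indep).
- by apply: sgp_ge_k; rewrite cardT; lia.
Qed.
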